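(* Let $\mathfrak{g}$ be a vector space over $\mathbf{k}$, let $\pi\in\mathrm{Hom}(\wedge^2\mathfrak{g},\mathfrak{g})$ and $T\in\mathrm{Hom}(\mathfrak{g},\mathfrak{g})$. Then $(s\pi,T)$ is a Maurer-Cartan element of the $L_\infty[1]$-algebra $s\mathfrak{m}\oplus\mathfrak{a}$ (described in the context) if and only if $(\mathfrak{g},\pi,T)$ is an extended Rota-Baxter Lie algebra of weight $(\mu,\lambda)$.
   Context: $\mathbf{k}$ is a field of characteristic $0$, $\mu,\lambda\in\mathbf{k}$, and $\mathbf{k}$ contains a square root $t=\sqrt{\mu^2-4\lambda}$. An extended Rota-Baxter Lie algebra of weight $(\mu,\lambda)$ is a triple $(\mathfrak{g},\pi=[-,-],T)$ with $(\mathfrak{g},\pi)$ a Lie algebra and $T:\mathfrak{g}\to\mathfrak{g}$ linear such that $[T(a),T(b)]=T([T(a),b]+[a,T(b)]+\mu[a,b])+\lambda[a,b]$ for all $a,b\in\mathfrak{g}$. Constants: $B_0=0$, $B_1=1$, $B_{n+1}=\mu B_n-\lambda B_{n-1}$ (i.e. $B_n=\frac1t((\frac{\mu+t}{2})^n-(\frac{\mu-t}{2})^n)$ formally), $A_n=\lambda B_n$ for $n\ge0$, $A_{-1}=-1$. $\mathfrak{m}=\mathfrak{a}=\mathrm{Hom}(\bigwedge\mathfrak{g},\mathfrak{g})=\bigoplus_{n\ge -1}\mathrm{Hom}(\wedge^{n+1}\mathfrak{g},\mathfrak{g})$, $|f|=n$ for $f\in\mathrm{Hom}(\wedge^{n+1}\mathfrak{g},\mathfrak{g})$;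 $(sV)^n=V^{n+1}$, so $sf$ has degree $|f|-1$. $\mathrm{Sh}(i_1,\dots,i_r)$ is the set of shuffles (permutations increasing on consecutive blocks of sizes $i_1,\dots,i_r$); sums with a negative block size are zero; $(F\sigma^{-1})(x_1,\dots,x_N):=F(x_{\sigma(1)},\dots,x_{\sigma(N)})$. Nijenhuis-Richardson bracket: $[P,Q]_{\mathrm{NR}}=P\bar\circ Q-(-1)^{pq}Q\bar\circ P$ for $|P|=p,|Q|=q$, with $(P\bar\circ Q)(x_1,\dots,x_{p+q+1})=\sum_{\sigma\in\mathrm{Sh}(q+1,p)}\mathrm{sgn}(\sigma)P(Q(x_{\sigma(1)},\dots,x_{\sigma(q+1)}),x_{\sigma(q+2)},\dots,x_{\sigma(p+q+1)})$. The $L_\infty[1]$-structure (graded symmetric degree $1$ maps satisfying the generalised Jacobi identities) on $s\mathfrak{m}\oplus\mathfrak{a}$ is: for $f\in\mathrm{Hom}(\wedge^{n+1}\mathfrak{g},\mathfrak{g})\subseteq\mathfrak{m}$, $g\in\mathfrak{m}$, $\xi_j\in\mathrm{Hom}(\wedge^{m_j+1}\mathfrak{g},\mathfrak{g})\subseteq\mathfrak{a}$: $l_1(sf)=-A_nf$, $l_2(sf,sg)=(-1)^{|f|}s[f,g]_{\mathrm{NR}}$, and for $i\ge2$ $$l_i(sf,\xi_1,\dots,\xi_{i-1})=-\sum_{\tau\in\mathrm{Sh}(m_1+1,\dots,m_{i-1}+1,n+2-i)}\mathrm{sgn}(\tau)A_{n-i+1}\big(f(\xi_1\otimes\cdots\otimes\xi_{i-1}\otimes\mathrm{Id}^{\otimes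 n+2-i})\big)\tau^{-1}$$ $$-\sum_{k=1}^{i-1}\sum_{\tau\in\mathrm{Sh}(m_1+1,\dots,\widehat{m_k+1},\dots,m_{i-1}+1,n+3-i,m_k)}\mathrm{sgn}(\tau)(-1)^{(n+\sum_{j<k}m_j)m_k}B_{n-i+3}\,\xi_k\big(f(\xi_1\otimes\cdots\widehat{\xi_k}\cdots\otimes\xi_{i-1}\otimes\mathrm{Id}^{\otimes n+3-i})\otimes\mathrm{Id}^{\otimes m_k}\big)\tau^{-1},$$ all other components (not determined by graded symmetry) being zero. Here $f(\eta_1\otimes\cdots\otimes\eta_p\otimes\mathrm{Id}^{\otimes q})$, with $\eta_a$ of degree $r_a$ (arity $r_a+1$), applies the $\eta_a$ to consecutive blocks of inputs, then $f$, with sign $(-1)^{\sum_{a<b}r_b(r_a+1)}$; and $\xi(F\otimes\mathrm{Id}^{\otimes r})$ inserts $F$ in the first slot of $\xi$ with no extra sign. A Maurer-Cartan element of an $L_\infty[1]$-algebra is a degree $0$ element $\alpha$ with $\sum_{n\ge1}\frac1{n!}l_n(\alpha^{\otimes n})=0$ (when the sum exists). *)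

(* Defs.v *)
From HB Require Import structures.
From mathcomp Require Import all_boot all_order all_algebra all_fingroup.
From mathcomp Require Import boolp classical_sets functions.

Set Implicit Arguments.
Unset Strict Implicit.
Unset Printing Implicit Defensive.

Import GRing.Theory Num.Theory.
Local Open Scope ring_scope.

(* Degree-0 elements alpha whose series \sum_(n >= 1) l_n(alpha,...,alpha)/n!
   has finitely many nonzero terms and vanishes; [l s] is l_(size s) on s. *)
Definition maurer_cartan (k : fieldType) (V : lmodType k)
    (deg : int -> V -> Prop) (l : seq V -> V) (alpha : V) : Prop :=
  deg 0 alpha /\
  exists N : nat,
    (forall n : nat, (N < n)%N -> l (nseq n alpha) = 0) /\
    \sum_(1 <= n < N.+1) (n`!%:R)^-1 *: l (nseq n alpha) = 0.

Section RotaBaxter.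
Variables (k : fieldType) (g : lmodType k).

Definition lie_bracket (br : g -> g -> g) : Prop :=
  [/\ forall (c : k) a b d, br (c *: a + b) d = c *: br a d + br b d,
      forall (c : k) a b d, br d (c *: a + b) = c *: br d a + br d b,
      forall a, br a a = 0
    & forall a b d, br a (br b d) + br b (br d a) + br d (br a b) = 0].

Definition extended_rota_baxter_lie (mu lambda : k)
    (br : g -> g -> g) (T : g -> g) : Prop :=
  [/\ lie_bracket br,
      forall (c : k) a b, T (c *: a + b) = c *: T a + T b
    & forall a b, br (T a) (T b) =
        T (br (T a) b + br a (T b) + mu *: br a b) + lambda *: br a b].

End RotaBaxter.

(* B_0 = 0, B_1 = 1, B_(n+2) = mu B_(n+1) - lambda B_n *)
Fixpoint Bpair (k : fieldType) (mu lambda : k) (n : nat) : k * k :=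
  if n is n'.+1 then
    let: (u, v) := Bpair mu lambda n' in (v, mu * v - lambda * u)
  else (0, 1).

Definition B (k : fieldType) (mu lambda : k) (n : nat) : k :=
  (Bpair mu lambda n).1.

(* Only A_n with n >= -1 is meaningful; the other negative indices are junk. *)
Definition A (k : fieldType) (mu lambda : k) (n : int) : k :=
  if n is Posz m then lambda * B mu lambda m else - 1.

Section Cochains.
Variables (k : fieldType) (g : lmodType k).
Implicit Types (F : seq g -> g) (x s : seq g).

(* An element of Hom(/\g, g) = (+)_N Hom(/\^N g, g) is encoded as a function F
   of finite lists: the restriction of F to lists of length N is its component
   in Hom(/\^N g, g), which is zero for all large N. *)
Definition multilinear F : Prop :=
  forall (c : k) a b s1 s2,
    F (s1 ++ (c *: a + b) :: s2) = c *: F (s1 ++ a :: s2) + F (s1 ++ b :: s2).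

Definition alternating F : Prop :=
  forall a s1 s2 s3, F (s1 ++ a :: s2 ++ a :: s3) = 0.

Definition finite_arities F : Prop :=
  exists M : nat, forall s, (M <= size s)%N -> F s = 0.

Definition is_cochain F : Prop :=
  [/\ multilinear F, alternating F & finite_arities F].

Definition cochain_pred : {pred (seq g -> g)} := fun F => `[< is_cochain F >].

Lemma cochain_submod_closed : submod_closed cochain_pred.
Proof.
split.
  apply/asboolP; split=> [c a b s1 s2|//|]; last by exists 0%N.
  by rewrite scaler0 addr0.
move=> c F G /asboolP[lF aF [M hM]] /asboolP[lG aG [M' hM']].
apply/asboolP; split.
- move=> d a b s1 s2; change (c *: F (s1 ++ (d *: a + b) :: s2) +
    G (s1 ++ (d *: a + b) :: s2) = d *: (c *: F (s1 ++ a :: s2) +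
    G (s1 ++ a :: s2)) + (c *: F (s1 ++ b :: s2) + G (s1 ++ b :: s2))).
  by rewrite lF lG !scalerDr !scalerA (mulrC d) addrACA.
- move=> a s1 s2 s3; change (c *: F (s1 ++ a :: s2 ++ a :: s3) +
    G (s1 ++ a :: s2 ++ a :: s3) = 0).
  by rewrite aF aG scaler0 addr0.
- exists (maxn M M') => s; rewrite geq_max => /andP[h h'].
  by change (c *: F s + G s = 0); rewrite hM ?hM' // scaler0 addr0.
Qed.

HB.instance Definition _ :=
  GRing.isSubmodClosed.Build k (seq g -> g) cochain_pred cochain_submod_closed.

Record cochain := Cochain {
  cochain_fun :> seq g -> g;
  cochainP : cochain_fun \in cochain_pred
}.

HB.instance Definition _ := [isSub for cochain_fun].
HB.instance Definition _ := [Choice of cochain by <:].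
HB.instance Definition _ := [SubChoice_isSubLmodule of cochain by <:].

Definition Mk_cochain F (hF : is_cochain F) : cochain :=
  Cochain (introT (asboolP _) hF : F \in cochain_pred).

(* |F| = n, i.e. F belongs to Hom(/\^(n+1) g, g) *)
Definition cochain_degree (n : int) (F : cochain) : Prop :=
  forall s, (size s)%:Z <> n + 1 -> F s = 0.

End Cochains.

Section Sh.
Variables (k : fieldType) (g : lmodType k).

Definition is_shuffle (bs : seq int) (N : nat) (sigma : 'S_N) : bool :=
  let sh := [seq absz b | b <- bs] in
  [&& all (fun b => 0 <= b) bs, sumn sh == N &
    [forall i : 'I_N, forall j : 'I_N,
      (i < j)%N && (reshape_index sh i == reshape_index sh j)
        ==> (sigma i < sigma j)%N]].

Definition permute (N : nat) (sigma : 'S_N) (x : seq g) : seq g :=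
  [seq x`_(sigma j) | j <- enum 'I_N].

(* \sum_(tau in Sh(bs)) sgn(tau) (Phi tau^-1)(x), where Phi receives its
   arguments cut into consecutive blocks of sizes bs; the sum is empty if
   some size is negative or if the sizes do not add up to size x. *)
Definition shuffle_sum (bs : seq int) (Phi : seq (seq g) -> g) (x : seq g) : g :=
  \sum_(tau : 'S_(size x) | is_shuffle bs tau)
    (-1) ^+ tau *: Phi (reshape [seq absz b | b <- bs] (permute tau x)).

End Sh.

Section Operations.
Variables (k : fieldType) (g : lmodType k) (mu lambda : k).
Local Notation C := (cochain g).
Local Notation sgn z := ((-1 : k) ^ (z : int)).

Definition remove_nth (T : Type) (j : nat) (s : seq T) : seq T :=
  take j s ++ drop j.+1 s.

(* P o-bar Q and the Nijenhuis-Richardson bracket for |P| = p, |Q| = q *)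
Definition nr_circ (p q : int) (P Q : C) (x : seq g) : g :=
  shuffle_sum [:: q + 1; p]
    (fun bl => P (Q (nth [::] bl 0) :: nth [::] bl 1)) x.

Definition nr_bracket (p q : int) (P Q : C) (x : seq g) : g :=
  nr_circ p q P Q x - sgn (p * q) *: nr_circ q p Q P x.

(* f(eta_1 (x) ... (x) eta_p (x) Id^q), |eta_a| = rs_a, on p + 1 blocks of
   arguments, the last one being that of Id^q *)
Definition insertion (f : C) (etas : seq C) (rs : seq int)
    (bl : seq (seq g)) : g :=
  sgn (\sum_(b < size etas) \sum_(a < b) rs`_b * (rs`_a + 1)) *:
    f ([seq u.1 u.2 | u : C * seq g <- zip etas bl] ++ nth [::] bl (size etas)).

(* l_i(sf, xi_1, ..., xi_(i-1)), i >= 1, for |f| = n and |xi_j| = ms_j *)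
Definition l_hom (n : int) (ms : seq int) (f : C) (xis : seq C)
    (x : seq g) : g :=
  let p := size xis in
  let i := p.+1%:Z in
  if p == 0%N then
    - (A mu lambda n *: (if (size x)%:Z == n + 1 then f x else 0))
  else
    - (A mu lambda (n - i + 1) *:
        shuffle_sum ([seq m + 1 | m <- ms] ++ [:: n + 2 - i])
          (insertion f xis ms) x)
    - \sum_(j < p)
        (sgn ((n + \sum_(j' < j) ms`_j') * ms`_j)
           * B mu lambda (absz (n - i + 3))) *:
        shuffle_sum
          ([seq m + 1 | m <- remove_nth j ms] ++ [:: n + 3 - i; ms`_j])
          (fun bl => nth 0 xis j
             (insertion f (remove_nth j xis) (remove_nth j ms) (take p bl)
                :: nth [::] bl p)) x.

(* The graded space sm (+) a: (F, X) stands for sF + X. *)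
Definition sma : lmodType k := (C * C)%type.

Definition sma_degree (d : int) (v : sma) : Prop :=
  cochain_degree (d + 1) v.1 /\ cochain_degree d v.2.

(* Multilinear extensions to inhomogeneous elements: sums over all the arities
   (arity = degree + 1) of the inputs.  At x, only arities below the bounds
   size x + 2 (resp. size x + size v + 1) can contribute. *)
Definition op_m_fun (P Q : C) (x : seq g) : g :=
  \sum_(b < (size x).+2) \sum_(a < (size x).+2)
    sgn (b%:Z - 1) *: nr_bracket (b%:Z - 1) (a%:Z - 1) P Q x.

(* The argument in sm may be in any position j: it is moved to the front with
   the Koszul sign, where |sf| = n - 1. *)
Definition op_a_fun (v : seq sma) (x : seq g) : g :=
  let bound := (size x + size v).+1 in
  \sum_(j < size v) \sum_(b < bound) \sum_(a : (size v).-1.-tuple 'I_bound)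
    let n := b%:Z - 1 in
    let ms := [seq (nat_of_ord c)%:Z - 1 | c : 'I_bound <- a] in
    sgn ((n - 1) * \sum_(j' < j) ms`_j') *:
      l_hom n ms (nth 0 v j).1 [seq w.2 | w <- remove_nth j v] x.

End Operations.

Section Closure.
Variables (k : fieldType) (g : lmodType k).
Implicit Types (F : seq g -> g) (x s : seq g).

Definition alternating_adj F : Prop :=
  forall a s1 s2, F (s1 ++ a :: a :: s2) = 0.

Lemma multilinear0 F s1 s2 : multilinear F -> F (s1 ++ 0 :: s2) = 0.
Proof.
move=> lF; have := lF 1 0 0 s1 s2; rewrite !scale1r addr0 => h.
by apply: (addrI (F (s1 ++ 0 :: s2))); rewrite addr0 -h.
Qed.

Lemma multilinearD F a b s1 s2 : multilinear F ->
  F (s1 ++ (a + b) :: s2) = F (s1 ++ a :: s2) + F (s1 ++ b :: s2).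
Proof. by move=> lF; have := lF 1 a b s1 s2; rewrite !scale1r. Qed.

Lemma alternating_adjP F :
  multilinear F -> alternating_adj F -> alternating F.
Proof.
move=> lF aF a s1 s2; elim: s2 s1 => [|c s2 IH] s1 s3 /=; first exact: aF.
have := aF (a + c) s1 (s2 ++ a :: s3).
have rc u v : s1 ++ u :: v :: s2 ++ a :: s3 = rcons s1 u ++ v :: s2 ++ a :: s3.
  by rewrite cat_rcons.
rewrite (multilinearD _ _ _ _ lF).
rewrite (rc a (a + c)) (multilinearD a c (rcons s1 a) _ lF) -!rc aF add0r.
rewrite (rc c (a + c)) (multilinearD a c (rcons s1 c) _ lF) -!rc aF addr0.
by rewrite (rc c a) IH addr0.
Qed.

Lemma cochain_lin (F : cochain g) : multilinear F.
Proof. by case/asboolP: (cochainP F). Qed.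

Lemma cochain_alt (F : cochain g) : alternating F.
Proof. by case/asboolP: (cochainP F). Qed.

Lemma cochain_adj (F : cochain g) : alternating_adj F.
Proof. by move=> a s1 s2; exact: (cochain_alt F a s1 [::] s2). Qed.

Lemma cochain_fin (F : cochain g) : finite_arities F.
Proof. by case/asboolP: (cochainP F). Qed.

(* multilinear maps of r blocks of arguments, alternating in each block, and
   zero when some block has at least M elements *)
Definition block_map (r M : nat) (Phi : seq (seq g) -> g) : Prop :=
  [/\ forall (c : k) a b s1 s2 B1 B2, (size B1 + size B2).+1 = r ->
        Phi (B1 ++ (s1 ++ (c *: a + b) :: s2) :: B2) =
        c *: Phi (B1 ++ (s1 ++ a :: s2) :: B2) + Phi (B1 ++ (s1 ++ b :: s2) :: B2),
      forall a s1 s2 B1 B2, (size B1 + size B2).+1 = r ->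
        Phi (B1 ++ (s1 ++ a :: a :: s2) :: B2) = 0
    & forall b B1 B2, (size B1 + size B2).+1 = r -> (M <= size b)%N ->
        Phi (B1 ++ b :: B2) = 0].

Lemma reshape_index_cons n sh i :
  reshape_index (n :: sh) i =
  if (i < n)%N then 0%N else (reshape_index sh (i - n)).+1.
Proof.
rewrite /reshape_index /= subn_eq0; case: leqP => // h.
by rewrite -subSn.
Qed.

Lemma reshape_split (sh : seq nat) (y1 : seq g) n2 :
  (size y1 + n2).+1 = sumn sh ->
  exists B1 s1 p2 q2, (size B1 + size q2).+1 = size sh /\
   forall v y2, size y2 = n2 ->
    reshape sh (y1 ++ v :: y2) =
     B1 ++ (s1 ++ v :: take p2 y2) :: reshape q2 (drop p2 y2).
Proof.
elim: sh y1 => [|n sh IH] y1 //= h.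
case: (ltnP (size y1) n) => hn.
  exists [::], y1, (n - (size y1).+1)%N, sh; split=> // v y2 _.
  rewrite take_cat ltnNge ltnW //= drop_cat ltnNge ltnW //=.
  by rewrite -(subnSK hn) /= .
have [|B1 [s1 [p2 [q2 [h1 h2]]]]] := IH (drop n y1).
  by rewrite size_drop; apply/eqP; rewrite -(eqn_add2l n) -h addnS addnA subnKC.
exists (take n y1 :: B1), s1, p2, q2; split=> /=; first by rewrite addSn h1.
by move=> v y2 hy; rewrite takel_cat // -h2 // drop_cat ltn_neqAle hn andbT;
  case: eqP => //= ->; rewrite subnn drop0 drop_size.
Qed.

Lemma reshape_split2 (sh : seq nat) (y1 y2 : seq g) (a : g) :
  size (y1 ++ a :: a :: y2) = sumn sh ->
  reshape_index sh (size y1) = reshape_index sh (size y1).+1 ->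
  exists B1 s1 s2 B2, (size B1 + size B2).+1 = size sh /\
    reshape sh (y1 ++ a :: a :: y2) = B1 ++ (s1 ++ a :: a :: s2) :: B2.
Proof.
elim: sh y1 => [|n sh IH] y1 /=; rewrite size_cat /= ?addnS // => h.
rewrite !reshape_index_cons; case: (ltnP (size y1) n) => hn.
  case: (ltnP (size y1).+1 n) => // hn' _.
  exists [::], y1, (take (n - (size y1).+2) y2), (reshape sh (drop (n - (size y1).+2) y2)).
  split; first by rewrite /= size_reshape.
  rewrite take_cat ltnNge ltnW //= drop_cat ltnNge ltnW //=.
  by rewrite -(subnSK hn) /= -(subnSK hn').
rewrite ltnNge (leq_trans hn) //= => -[]; rewrite subSn // => hi.
have [||B1 [s1 [s2 [B2 [h1 h2]]]]] := IH (drop n y1).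
- rewrite size_cat /= size_drop !addnS; apply/eqP.
  by rewrite -(eqn_add2l n) -h !addnS addnA subnKC.
- by rewrite size_drop.
exists (take n y1 :: B1), s1, s2, B2; split=> /=; first by rewrite addSn h1.
rewrite takel_cat // -h2 // drop_cat ltn_neqAle hn andbT.
by case: eqP => //= ->; rewrite subnn drop0 drop_size.
Qed.

Lemma reshape_index_homo sh i j : (i <= j)%N ->
  (reshape_index sh i <= reshape_index sh j)%N.
Proof.
elim: sh i j => [|n sh IH] i j hij; first by rewrite /reshape_index.
rewrite !reshape_index_cons; case: (ltnP i n) => // hi.
case: (ltnP j n) => hj; last by rewrite ltnS IH // leq_sub2r.
by move: (leq_trans hi hij); rewrite leqNgt hj.
Qed.

Lemma size_permute N (tau : 'S_N) x : size (permute tau x) = N.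
Proof. by rewrite size_map size_enum_ord. Qed.

Lemma nth_permute N (tau : 'S_N) x (j : 'I_N) :
  (permute tau x)`_j = x`_(tau j).
Proof. by rewrite (nth_map j) ?size_enum_ord // nth_ord_enum. Qed.

Lemma permute_split (N n1 : nat) (tau : 'S_N) (hn1 : (n1 < N)%N) v s1 s2 :
  size s1 = n1 -> size (s1 ++ v :: s2) = N ->
  let p := tau^-1%g (Ordinal hn1) in
  forall w, permute tau (s1 ++ w :: s2) =
    take p (permute tau (s1 ++ v :: s2)) ++ w ::
    drop p.+1 (permute tau (s1 ++ v :: s2)).
Proof.
move=> h1 hN p w; set y := permute tau (s1 ++ v :: s2).
have hy : size y = N by rewrite size_permute.
have hp : (p < size y)%N by rewrite hy.
apply: (@eq_from_nth _ 0).
  by rewrite size_cat /= (size_takel (ltnW hp)) size_drop size_permute hy subnSK // subnKC // ltnW.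
rewrite size_permute => j hj; rewrite nth_cat (size_takel (ltnW hp)).
rewrite -[j]/(nat_of_ord (Ordinal hj)) nth_permute /=.
case: (ltngtP j p) => hjp.
- rewrite nth_take // -[j]/(nat_of_ord (Ordinal hj)) nth_permute /=.
  rewrite !nth_cat; case: ltnP => // hge; rewrite h1.
  case: (posnP (tau (Ordinal hj) - n1)) => [|]; last by case: (_ - _)%N.
  move=> /eqP; rewrite subn_eq0 => hle.
  have e : tau (Ordinal hj) = Ordinal hn1.
    by apply/val_inj/eqP; rewrite /= eqn_leq hle -h1.
  by move: hjp; rewrite /p -e permK /= ltnn.
- have -> : (j - p = (j - p.+1).+1)%N by rewrite subnSK.
  rewrite /= nth_drop subnKC // -[j]/(nat_of_ord (Ordinal hj)) nth_permute /=.
  rewrite !nth_cat; case: ltnP => // hge; rewrite h1.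
  case: (posnP (tau (Ordinal hj) - n1)) => [|]; last by case: (_ - _)%N.
  move=> /eqP; rewrite subn_eq0 => hle.
  have e : tau (Ordinal hj) = Ordinal hn1.
    by apply/val_inj/eqP; rewrite /= eqn_leq hle -h1.
  by move: hjp; rewrite /p -e permK /= ltnn.
- have -> : Ordinal hj = p by apply/val_inj.
  by rewrite permKV /= nth_cat h1 ltnn subnn hjp subnn.
Qed.

Lemma permute_lin (bs : seq int) M Phi (c : k) a b s1 s2 N (tau : 'S_N) :
  block_map (size bs) M Phi -> is_shuffle bs tau ->
  size (s1 ++ a :: s2) = N ->
  let P w := Phi (reshape [seq absz b | b <- bs] (permute tau (s1 ++ w :: s2))) in
  P (c *: a + b) = c *: P a + P b.
Proof.
move=> [lP _ _] /and3P[_ /eqP hsum _] hN P.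
have hn1 : (size s1 < N)%N by rewrite -hN size_cat /= addnS ltnS leq_addr.
have /= pS := @permute_split N _ tau hn1 a s1 s2 erefl hN.
set y1 := take _ _ in pS; set y2 := drop _ _ in pS.
rewrite /P !pS.
have [|B1 [t1 [p2 [q2 [h1 h2]]]]] := @reshape_split [seq absz b | b <- bs] y1 (size y2).
  by rewrite hsum -(size_permute tau (s1 ++ a :: s2)) (pS a) size_cat addnS.
by rewrite !h2 // lP // size_reshape h1 size_map.
Qed.

Lemma permute_adj (bs : seq int) M Phi a s1 s2 N (tau : 'S_N)
    (i0 i1 : 'I_N) :
  block_map (size bs) M Phi -> is_shuffle bs tau ->
  size (s1 ++ a :: a :: s2) = N -> i0 = size s1 :> nat -> i1 = (size s1).+1 :> nat ->
  let sh := [seq absz b | b <- bs] in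
  reshape_index sh (tau^-1%g i0) = reshape_index sh (tau^-1%g i1) ->
  Phi (reshape sh (permute tau (s1 ++ a :: a :: s2))) = 0.
Proof.
move=> [_ aP _] /and3P[_ /eqP hsum /forallP hsh] hN e0 e1 sh hb.
set p := tau^-1%g i0 in hb *; set q := tau^-1%g i1 in hb *.
have tp : tau p = i0 by rewrite permKV.
have tq : tau q = i1 by rewrite permKV.
have mono (u v : 'I_N) : (u < v)%N -> reshape_index sh u = reshape_index sh v ->
    (tau u < tau v)%N.
  by move=> huv e; move/forallP/(_ v)/implyP: (hsh u); apply; rewrite huv e eqxx.
have hpq : (p < q)%N.
  case: (ltngtP p q) => // h.
    by have := mono _ _ h (esym hb); rewrite tp tq e0 e1 ltnNge leqnSn.
  by have /(congr1 tau) := val_inj h; rewrite tp tq => /(congr1 val) /=;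
     rewrite e0 e1 => /eqP; rewrite ltn_eqF.
have hq : q = p.+1 :> nat.
  apply/eqP; rewrite eqn_leq hpq andbT leqNgt; apply/negP => h.
  have hr : (p.+1 < N)%N := ltn_trans h (ltn_ord q).
  pose r := Ordinal hr.
  have er : reshape_index sh r = reshape_index sh p.
    have l1 : (reshape_index sh p <= reshape_index sh r)%N.
      exact: reshape_index_homo (leqnSn p).
    have l2 : (reshape_index sh r <= reshape_index sh q)%N.
      exact: reshape_index_homo (ltnW h).
    by apply/eqP; rewrite eqn_leq l1 andbT hb l2.
  have h1 : (tau p < tau r)%N by apply: mono; rewrite ?er.
  have h2 : (tau r < tau q)%N by apply: mono; rewrite ?er.
  by move: h1 h2; rewrite tp tq e0 e1 => h1; rewrite ltnNge h1.
set y := permute tau _.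
have sy : size y = N by rewrite size_permute.
have yE : y = take p y ++ a :: a :: drop p.+2 y.
  have hp' : (p < size y)%N by rewrite sy.
  have hp2 : (p.+1 < size y)%N by rewrite sy -hq.
  have yp : y`_p = a by rewrite nth_permute tp nth_cat e0 ltnn subnn.
  have yq : y`_p.+1 = a.
    by rewrite -hq nth_permute tq nth_cat e1 ltnNge leqnSn subSnn.
  by rewrite -{1}(cat_take_drop p y) (drop_nth 0) // (drop_nth 0 hp2) yp yq.
have st : size (take p y) = p by rewrite size_takel // sy ltnW.
have [||B1 [t1 [t2 [B2 [h1 h2]]]]] :=
    @reshape_split2 sh (take p y) (drop p.+2 y) a.
- by rewrite -yE sy hsum.
- by rewrite st -hq.
by rewrite yE h2 aP // h1 size_map.
Qed.

Lemma shuffle_tperm (bs : seq int) N (tau : 'S_N) (i0 i1 : 'I_N) :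
  let sh := [seq absz b | b <- bs] in
  i1 = i0.+1 :> nat ->
  reshape_index sh (tau^-1%g i0) <> reshape_index sh (tau^-1%g i1) ->
  is_shuffle bs tau -> is_shuffle bs (tau * tperm i0 i1)%g.
Proof.
move=> sh e1 hb /and3P[h1 h2 /forallP hsh]; apply/and3P; split=> //.
apply/forallP => u; apply/forallP => v; apply/implyP => /andP[huv e].
move/forallP/(_ v)/implyP: (hsh u); rewrite huv e => /(_ isT) hlt.
rewrite !permM; case: tpermP => [hu|hu|/eqP hu0 /eqP hu1].
- case: tpermP => [hv|hv|/eqP hv0 /eqP hv1].
  + by move: hlt; rewrite hu hv ltnn.
  + by case: hb; rewrite -hu -hv !permK; apply/eqP.
  + move: hlt; rewrite hu e1 => hlt; rewrite ltn_neqAle hlt andbT -e1.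
    by rewrite eq_sym.
- case: tpermP => [hv|hv|/eqP hv0 /eqP hv1].
  + by rewrite e1.
  + by move: hlt; rewrite hu hv ltnn.
  + by apply: leq_ltn_trans hlt; rewrite hu e1.
- case: tpermP => [hv|hv|/eqP hv0 /eqP hv1] //.
  + by rewrite e1 ltnS ltnW // -hv.
  + move: hlt; rewrite hv e1 ltnS => hlt; rewrite ltn_neqAle hlt andbT.
    exact: hu0.
Qed.

Lemma permute_tperm N (tau : 'S_N) (i0 i1 : 'I_N) a s1 s2 :
  i0 = size s1 :> nat -> i1 = (size s1).+1 :> nat ->
  permute (tau * tperm i0 i1)%g (s1 ++ a :: a :: s2) =
  permute tau (s1 ++ a :: a :: s2).
Proof.
move=> e0 e1; apply: eq_map => j; rewrite permM.
by case: tpermP => [->|->|//]; rewrite !nth_cat e0 e1 ltnn subnn ltnNge leqnSn subSnn.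
Qed.

Lemma shuffle_sum_lin bs M Phi :
  block_map (size bs) M Phi -> multilinear (@shuffle_sum k g bs Phi).
Proof.
move=> hPhi c a b s1 s2; rewrite /shuffle_sum.
have -> : size (s1 ++ a :: s2) = size (s1 ++ (c *: a + b) :: s2).
  by rewrite !size_cat.
have -> : size (s1 ++ b :: s2) = size (s1 ++ (c *: a + b) :: s2).
  by rewrite !size_cat.
rewrite scaler_sumr -big_split; apply: eq_bigr => tau htau /=.
rewrite (permute_lin c b hPhi htau) ?size_cat //.
by rewrite scalerDr !scalerA mulrC.
Qed.

Lemma shuffle_sum_adj bs M Phi :
  block_map (size bs) M Phi -> alternating_adj (@shuffle_sum k g bs Phi).
Proof.
move=> hPhi a s1 s2; rewrite /shuffle_sum; set x := s1 ++ _; set N := size x.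
have hN : N = (size s1 + (size s2).+2)%N by rewrite /N size_cat.
have h0 : (size s1 < N)%N by rewrite hN addnS ltnS leq_addr.
have h1 : ((size s1).+1 < N)%N by rewrite hN !addnS !ltnS leq_addr.
pose i0 := Ordinal h0; pose i1 := Ordinal h1; pose t := tperm i0 i1.
set sh := [seq absz b | b <- bs].
pose same (tau : 'S_N) :=
  reshape_index sh (tau^-1%g i0) == reshape_index sh (tau^-1%g i1).
pose lt (tau : 'S_N) := (tau^-1%g i0 < tau^-1%g i1)%N.
rewrite (bigID same) /= big1 ?add0r; last first.
  move=> tau /andP[htau /eqP hs].
  by rewrite (permute_adj hPhi htau (i0 := i0) (i1 := i1)) // scaler0.
rewrite (bigID lt) /= [X in _ + X](reindex_inj (mulIg t)) /=.
have E (tau : 'S_N) : is_shuffle bs (tau * t)%g && ~~ same (tau * t)%g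
      && ~~ lt (tau * t)%g = (is_shuffle bs tau && ~~ same tau && lt tau).
  have inv0 (s : 'S_N) : (s * t)^-1%g i0 = s^-1%g i1.
    by rewrite invMg permM tpermV tpermL.
  have inv1 (s : 'S_N) : (s * t)^-1%g i1 = s^-1%g i0.
    by rewrite invMg permM tpermV tpermR.
  have es (s : 'S_N) : same (s * t)%g = same s by rewrite /same inv0 inv1 eq_sym.
  have el (s : 'S_N) : ~~ same s -> ~~ lt (s * t)%g = lt s.
    move=> hs; rewrite /lt inv0 inv1 -leqNgt leq_eqVlt.
    case: eqP => // /val_inj /perm_inj /(congr1 val) /= /eqP.
    by rewrite ltn_eqF.
  rewrite es; case hs: (same tau); first by rewrite !andbF.
  rewrite el ?hs // !andbT; congr (_ && _); apply/idP/idP => h; last first.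
    by apply: shuffle_tperm => //; apply/eqP; rewrite -/sh -/(same tau) hs.
  have -> : tau = ((tau * t) * t)%g by rewrite -mulgA tperm2 mulg1.
  apply: shuffle_tperm => //; apply/eqP.
  by rewrite -/sh -/(same (tau * t)%g) es hs.
rewrite (eq_bigl _ _ E) -big_split big1 //= => tau _.
rewrite permute_tperm // odd_permM odd_tperm.
rewrite -scalerDl; suff -> : i0 != i1 by case: (odd_perm tau); rewrite /= ?expr0 ?expr1 ?addNr ?addrN scale0r.
by apply/eqP => /(congr1 val) /= /eqP; rewrite ltn_eqF.
Qed.

Lemma shuffle_sum_supp bs M Phi x :
  block_map (size bs) M Phi -> (size bs * M < size x)%N ->
  shuffle_sum bs Phi x = 0.
Proof.
move=> [_ _ sP] hx; rewrite /shuffle_sum big1 // => tau /and3P[_ /eqP hs _].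
set sh := [seq absz b | b <- bs] in hs *.
set y := permute tau x.
have hy : shape (reshape sh y) = sh by rewrite reshapeKl // size_permute hs.
have : has (fun b => M <= size b)%N (reshape sh y).
  apply: contraLR hx; rewrite -leqNgt -all_predC -hs => h.
  have -> : size bs = size (reshape sh y) by rewrite size_reshape size_map.
  rewrite -[X in sumn X]hy; elim: (reshape sh y) h => //= b B IH /andP[h /IH h2].
  by rewrite mulSn leq_add // ltnW // ltnNge.
case/hasP => b hb hM; case/splitPr: hb (size_reshape sh y) => B1 B2 hB.
by rewrite sP ?scaler0 // -(size_map absz bs) -hB size_cat /= addnS.
Qed.


Definition vanish_from (M : nat) F : Prop := forall s, (M <= size s)%N -> F s = 0.

Lemma insertion_split (f : cochain g) (etas : seq (cochain g)) rs B1 B2 :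
  (size B1 + size B2)%N = size etas ->
  exists u : k,
  (exists Z, forall b, insertion f etas rs (B1 ++ b :: B2) = u *: f (Z ++ b)) \/
  (exists Z1 e Z2, e \in etas /\
     forall b, insertion f etas rs (B1 ++ b :: B2) = u *: f (Z1 ++ e b :: Z2)).
Proof.
move=> h; rewrite /insertion; eexists; case: B2 h => [|c B2] h.
  left; exists [seq u.1 u.2 | u : cochain g * seq g <- zip etas B1] => b.
  rewrite addn0 in h; congr (_ *: f (_ ++ _)); last by rewrite -h nth_cat ltnn subnn.
  by rewrite -[etas]cats0 zip_cat // cats0 /= cats0.
right; have hlt : (size B1 < size etas)%N by rewrite -h /= addnS ltnS leq_addr.
set e := nth 0 etas (size B1).
exists [seq u.1 u.2 | u : cochain g * seq g <- zip (take (size B1) etas) B1], e.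
exists ([seq u.1 u.2 | u : cochain g * seq g <- zip (drop (size B1).+1 etas) (c :: B2)] ++
        nth [::] (c :: B2) (size B2)).
split; first exact: mem_nth.
move=> b; congr (_ *: f _).
rewrite -{1}(cat_take_drop (size B1) etas) (drop_nth 0 hlt) zip_cat; last first.
  by rewrite size_takel // ltnW.
rewrite map_cat -catA [zip (_ :: _) _]/= map_cons -/e -h nth_cat.
rewrite ltnNge leq_addr /= addKn /=.
by case: (drop _ etas).
Qed.

Lemma insertion_block (f : cochain g) (etas : seq (cochain g)) rs M :
  vanish_from M f -> (forall e, e \in etas -> vanish_from M e) ->
  block_map (size etas).+1 M (insertion f etas rs).
Proof.
move=> hf he; split.
- move=> c a b s1 s2 B1 B2 [/(insertion_split f rs)[u [[Z h]|[Z1 [e [Z2 [_ h]]]]]]]; rewrite !h.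
    by rewrite !catA cochain_lin scalerDr !scalerA mulrC.
  by rewrite !cochain_lin scalerDr !scalerA mulrC.
- move=> a s1 s2 B1 B2 [/(insertion_split f rs)[u [[Z h]|[Z1 [e [Z2 [_ h]]]]]]]; rewrite !h.
    by rewrite !catA cochain_adj scaler0.
  by rewrite cochain_adj multilinear0 ?scaler0 //; exact: cochain_lin.
- move=> b B1 B2 [/(insertion_split f rs)[u [[Z h]|[Z1 [e [Z2 [he' h]]]]]]] hb; rewrite h.
    by rewrite hf ?scaler0 // size_cat (leq_trans hb) // leq_addl.
  by rewrite (he _ he' _ hb) multilinear0 ?scaler0 //; exact: cochain_lin.
Qed.

Lemma head_block (P : cochain g) r M Psi :
  vanish_from M P -> block_map r M Psi ->
  block_map r.+1 M (fun bl => P (Psi (take r bl) :: nth [::] bl r)).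
Proof.
move=> hP [lP aP sP].
have E B1 B2 : (size B1 + size B2)%N = r ->
    (B2 = [::] /\ forall b, P (Psi (take r (B1 ++ b :: B2)) ::
         nth [::] (B1 ++ b :: B2) r) = P ([:: Psi B1] ++ b)) \/
    exists B2' y, (size B1 + size B2').+1 = r /\
      forall b, P (Psi (take r (B1 ++ b :: B2)) :: nth [::] (B1 ++ b :: B2) r)
        = P ([::] ++ Psi (B1 ++ b :: B2') :: y).
  case/lastP: B2 => [|B2 y] h.
    left; split=> // b; rewrite addn0 in h.
    by rewrite -h take_size_cat // nth_cat ltnn subnn.
  right; exists B2, y; rewrite size_rcons addnS in h; split=> // b.
  have e : B1 ++ b :: rcons B2 y = (B1 ++ b :: B2) ++ [:: y].
    by rewrite -catA /= cats1.
  have sz : size (B1 ++ b :: B2) = r by rewrite size_cat /= addnS.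
  by rewrite e take_cat nth_cat sz ltnn subnn /= cats0.
split.
- move=> c a b s1 s2 B1 B2 [/E[[_ h]|[B2' [y [hr h]]]]]; rewrite !h.
    by rewrite !catA cochain_lin.
  by rewrite lP // cochain_lin.
- move=> a s1 s2 B1 B2 [/E[[_ h]|[B2' [y [hr h]]]]]; rewrite !h.
    by rewrite !catA cochain_adj.
  by rewrite aP // multilinear0 //; exact: cochain_lin.
- move=> b B1 B2 [/E[[_ h]|[B2' [y [hr h]]]]] hb; rewrite !h.
    by rewrite hP // size_cat (leq_trans hb) // leq_addl.
  by rewrite sP // multilinear0 //; exact: cochain_lin.
Qed.

Definition mult_adj F : Prop := multilinear F /\ alternating_adj F.

Lemma mult_adj_ext F G : F =1 G -> mult_adj F -> mult_adj G.
Proof. by move=> /funext ->. Qed.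

Lemma mult_adj0 : mult_adj (fun _ : seq g => 0 : g).
Proof. by split=> // c a b s1 s2; rewrite scaler0 addr0. Qed.

Lemma mult_adjZ (u : k) F : mult_adj F -> mult_adj (fun x => u *: F x).
Proof.
move=> [lF aF]; split=> [c a b s1 s2|a s1 s2]; last by rewrite aF scaler0.
by rewrite lF scalerDr !scalerA mulrC.
Qed.

Lemma mult_adjD F G : mult_adj F -> mult_adj G -> mult_adj (fun x => F x + G x).
Proof.
move=> [lF aF] [lG aG]; split=> [c a b s1 s2|a s1 s2].
  by rewrite lF lG scalerDr addrACA.
by rewrite aF aG addr0.
Qed.

Lemma mult_adjN F : mult_adj F -> mult_adj (fun x => - F x).
Proof. by move/(mult_adjZ (-1)); apply: mult_adj_ext => x; rewrite scaleN1r. Qed.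

Lemma mult_adj_sum (I : finType) (G : I -> seq g -> g) :
  (forall i, mult_adj (G i)) -> mult_adj (fun x => \sum_i G i x).
Proof.
move=> hG; split=> [c a b s1 s2|a s1 s2].
  by rewrite scaler_sumr -big_split; apply: eq_bigr => i _; case: (hG i) => ->.
by rewrite big1 // => i _; case: (hG i) => _ ->.
Qed.

Lemma mult_adj_size (G : nat -> seq g -> g) :
  (forall N, mult_adj (G N)) -> mult_adj (fun x => G (size x) x).
Proof.
move=> hG; split=> [c a b s1 s2|a s1 s2]; last by case: (hG (size (s1 ++ [:: a, a & s2]))) => _ ->.
have e w : size (s1 ++ w :: s2) = (size s1 + (size s2).+1)%N by rewrite size_cat.
by rewrite !e; case: (hG (size s1 + (size s2).+1)%N) => ->.
Qed.

Lemma mult_adj_cochain (F : cochain g) : mult_adj F.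
Proof. by split; [exact: cochain_lin | exact: cochain_adj]. Qed.

Lemma mult_adj_shuffle bs M Phi :
  block_map (size bs) M Phi -> mult_adj (shuffle_sum bs Phi).
Proof.
by move=> h; split; [exact: shuffle_sum_lin h | exact: shuffle_sum_adj h].
Qed.

Lemma vanish_from_le M M' F : (M <= M')%N -> vanish_from M F -> vanish_from M' F.
Proof. by move=> h hF s /(leq_trans h)/hF. Qed.

Lemma vanish_from_all (l : seq (cochain g)) :
  exists M, forall e, e \in l -> vanish_from M e.
Proof.
elim: l => [|a l [M hM]]; first by exists 0%N.
have [M' hM'] := cochain_fin a; exists (maxn M M') => e; rewrite inE.
case/orP => [/eqP->|/hM]; first exact: vanish_from_le (leq_maxr _ _) hM'.
exact: vanish_from_le (leq_maxl _ _).
Qed.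

Lemma size_remove_nth T (s : seq T) j :
  (j < size s)%N -> (size (remove_nth j s)).+1 = size s.
Proof.
by move=> h; rewrite size_cat size_drop size_takel 1?ltnW // -addnS subnSK // subnKC // ltnW.
Qed.

Lemma mem_remove_nth (T : eqType) (s : seq T) j a : a \in remove_nth j s -> a \in s.
Proof. by rewrite mem_cat => /orP[/mem_take|/mem_drop]. Qed.

Lemma nr_circ_block (P Q : cochain g) M :
  vanish_from M P -> vanish_from M Q ->
  block_map 2 M (fun bl => P (Q (nth [::] bl 0) :: nth [::] bl 1)).
Proof.
move=> hP hQ.
have h1 : block_map 1 M (fun bl => Q (nth [::] bl 0)).
  split=> [c a b s1 s2 [|//] B2 _|a s1 s2 [|//] B2 _|b [|//] B2 _ hb] /=.
  - exact: cochain_lin.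
  - exact: cochain_adj.
  - exact: hQ.
have := head_block hP h1.
suff -> : (fun bl => P (Q (nth [::] (take 1 bl) 0) :: nth [::] bl 1)) =
  (fun bl => P (Q (nth [::] bl 0) :: nth [::] bl 1)) by [].
by apply/funext => bl; rewrite nth_take.
Qed.

Lemma nr_bracket_mult_adj p q (P Q : cochain g) : mult_adj (nr_bracket p q P Q).
Proof.
have [M hM] := vanish_from_all [:: P; Q].
have hP : vanish_from M P by apply: hM; rewrite !inE eqxx.
have hQ : vanish_from M Q by apply: hM; rewrite !inE eqxx orbT.
apply: mult_adjD; last apply/mult_adjN/mult_adjZ.
  by apply: mult_adj_shuffle; exact: nr_circ_block hP hQ.
by apply: mult_adj_shuffle; exact: nr_circ_block hQ hP.
Qed.

Lemma nr_bracket_vanish p q (P Q : cochain g) M :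
  vanish_from M P -> vanish_from M Q -> vanish_from (2 * M).+1 (nr_bracket p q P Q).
Proof.
move=> hP hQ x hx; rewrite /nr_bracket /nr_circ.
rewrite (@shuffle_sum_supp [:: q + 1; p] M) //; last exact: nr_circ_block.
rewrite (@shuffle_sum_supp [:: p + 1; q] M) ?scaler0 ?subr0 //.
exact: nr_circ_block.
Qed.

Variables mu lambda : k.

Lemma l_hom_block (ms : seq int) (f : cochain g) (xis : seq (cochain g)) M (j : 'I_(size xis)) :
  vanish_from M f -> (forall e, e \in xis -> vanish_from M e) ->
  block_map (size xis).+1 M
    (fun bl => nth 0 xis j
       (insertion f (remove_nth j xis) (remove_nth j ms) (take (size xis) bl)
          :: nth [::] bl (size xis))).
Proof.
move=> hf he; apply: head_block; first by apply: he; exact: mem_nth.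
have he' e : e \in remove_nth j xis -> vanish_from M e.
  by move=> /mem_remove_nth; apply: he.
by have := insertion_block (remove_nth j ms) hf he'; rewrite size_remove_nth.
Qed.

Lemma l_hom_mult_adj n ms (f : cochain g) (xis : seq (cochain g)) :
  size ms = size xis -> mult_adj (l_hom mu lambda n ms f xis).
Proof.
move=> hms; have [M hM] := vanish_from_all (f :: xis).
have hf : vanish_from M f by apply: hM; rewrite inE eqxx.
have he e : e \in xis -> vanish_from M e by move=> h; apply: hM; rewrite inE h orbT.
rewrite /l_hom; case: eqP => [h0|/eqP hp].
  apply/mult_adjN/mult_adjZ.
  apply: (@mult_adj_size (fun N x => if N%:Z == n + 1 then f x else 0)) => N.
  by case: eqP => _; [exact: mult_adj_cochain | exact: mult_adj0].
apply: mult_adjD; apply: mult_adjN; last first.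
  apply: mult_adj_sum => j; apply/mult_adjZ/(@mult_adj_shuffle _ M).
  rewrite size_cat size_map /= addn2 size_remove_nth hms //.
  exact: l_hom_block.
apply/mult_adjZ/(@mult_adj_shuffle _ M).
by rewrite size_cat size_map /= addn1 hms; exact: insertion_block.
Qed.

Lemma l_hom_vanish n ms (f : cochain g) (xis : seq (cochain g)) M :
  size ms = size xis ->
  vanish_from M f -> (forall e, e \in xis -> vanish_from M e) ->
  vanish_from ((size xis).+1 * M).+1 (l_hom mu lambda n ms f xis).
Proof.
move=> hms hf he x hx; rewrite /l_hom; case: eqP => [h0|/eqP hp].
  rewrite hf ?if_same ?scaler0 ?oppr0 //.
  by move: hx; rewrite h0 mul1n; exact: ltnW.
have vanish bs Phi : size bs = (size xis).+1 ->
    block_map (size xis).+1 M Phi -> shuffle_sum bs Phi x = 0.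
  by move=> hs; rewrite -hs in hx * => hb; apply: shuffle_sum_supp hb hx.
rewrite vanish ?size_cat ?size_map /= ?addn1 ?hms //; last exact: insertion_block.
rewrite big1 ?scaler0 ?subr0 ?oppr0 // => j _.
rewrite vanish ?size_cat ?size_map /= ?addn2 ?size_remove_nth ?hms ?scaler0 //.
exact: l_hom_block.
Qed.

Lemma mult_adj_is_cochain F M : mult_adj F -> vanish_from M F -> is_cochain F.
Proof.
by move=> [lF aF] hF; split=> //; [exact: alternating_adjP | exists M].
Qed.

Lemma op_m_is_cochain (P Q : cochain g) : is_cochain (op_m_fun P Q).
Proof.
have [M hM] := vanish_from_all [:: P; Q].
have hP : vanish_from M P by apply: hM; rewrite !inE eqxx.
have hQ : vanish_from M Q by apply: hM; rewrite !inE eqxx orbT.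
apply: (@mult_adj_is_cochain _ (2 * M).+1).
  apply: (@mult_adj_size (fun N x => \sum_(b < N.+2) \sum_(a < N.+2)
    ((-1 : k) ^ (b%:Z - 1)) *: nr_bracket (b%:Z - 1) (a%:Z - 1) P Q x)) => N.
  apply: mult_adj_sum => b; apply: mult_adj_sum => a; apply: mult_adjZ.
  exact: nr_bracket_mult_adj.
move=> x hx; rewrite /op_m_fun big1 // => b _; rewrite big1 // => a _.
by rewrite (nr_bracket_vanish _ _ hP hQ) // scaler0.
Qed.

Lemma op_a_is_cochain (v : seq (sma g)) : is_cochain (op_a_fun mu lambda v).
Proof.
have [M hM] := vanish_from_all ([seq w.1 | w <- v] ++ [seq w.2 | w <- v]).
have h1 (j : 'I_(size v)) : vanish_from M (nth 0 v j).1.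
  by apply: hM; rewrite mem_cat map_f // mem_nth.
have h2 (j : 'I_(size v)) e : e \in [seq w.2 | w <- remove_nth j v] -> vanish_from M e.
  case/mapP => w /mem_remove_nth hw ->; apply: hM.
  by rewrite mem_cat (map_f snd hw) orbT.
have hs (j : 'I_(size v)) : size [seq w.2 | w <- remove_nth j v] = (size v).-1.
  by rewrite size_map; have /(congr1 predn) := size_remove_nth (ltn_ord j).
apply: (@mult_adj_is_cochain _ (size v * M).+1).
  apply: (@mult_adj_size (fun N x =>
   \sum_(j < size v) \sum_(b < (N + size v).+1)
   \sum_(a : (size v).-1.-tuple 'I_(N + size v).+1)
    let n := b%:Z - 1 in
    let ms := [seq (nat_of_ord c)%:Z - 1 | c : 'I_(N + size v).+1 <- a] in
    ((-1 : k) ^ ((n - 1) * \sum_(j' < j) ms`_j')) *: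
      l_hom mu lambda n ms (nth 0 v j).1 [seq w.2 | w <- remove_nth j v] x)) => N.
  apply: mult_adj_sum => j; apply: mult_adj_sum => b; apply: mult_adj_sum => a.
  by apply/mult_adjZ/l_hom_mult_adj; rewrite hs size_map size_tuple.
move=> x hx; rewrite /op_a_fun; rewrite big1 // => j _; rewrite big1 // => b _.
rewrite big1 // => a _; rewrite (l_hom_vanish _ _ (h1 j) (h2 j)) ?scaler0 //.
  by rewrite hs size_map size_tuple.
by rewrite hs prednK // (leq_trans _ (ltn_ord j)).
Qed.

End Closure.

Section LInfinity.
Variables (k : fieldType) (g : lmodType k) (mu lambda : k).

Definition op_m (P Q : cochain g) : cochain g := Mk_cochain (op_m_is_cochain P Q).

Definition op_a (v : seq (sma g)) : cochain g :=
  Mk_cochain (op_a_is_cochain mu lambda v).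

(* l_i(v_1, ..., v_i) with i = size v.  The sm-component comes only from l_2 on
   two elements of sm; the a-component is linear in the sm-parts. *)
Definition l_sma (v : seq (sma g)) : sma g :=
  (if v is [:: v1; v2] then op_m v1.1 v2.1 else 0, op_a v).

End LInfinity.

(* Main.v *)
(* For degree reasons the Maurer-Cartan series of alpha = (s pi, T) has only
   the terms
     l_1 = - lambda pi,
     l_2 = (- 2 s Jac(pi), - 2 mu T pi),
     l_3 = 6 (pi(T, T) - T (pi(T, 1) + pi(1, T))),
   since A_0 = B_0 = 0 kills the remaining terms of l_2 and l_4.  Hence the
   s m-component of the equation is the Jacobi identity and the a-component is
   the extended Rota-Baxter identity. *)
Require Import Defs.
From mathcomp Require Import all_boot all_order all_algebra perm zify.
From mathcomp Require Import boolp.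

Import GRing.Theory.
Local Open Scope ring_scope.

(** * Shuffle sums with two or three arguments *)

Lemma is_shuffleP (bs : seq int) (N : nat) (s : 'S_N) :
  all (fun b => 0 <= b) bs -> sumn [seq absz b | b <- bs] = N ->
  is_shuffle bs s <-> forall i j : 'I_N, (i < j)%N ->
    reshape_index [seq absz b | b <- bs] i =
      reshape_index [seq absz b | b <- bs] j -> (s i < s j)%N.
Proof.
move=> bs_ge0 szN; rewrite /is_shuffle bs_ge0 szN eqxx /=; split.
  move=> /forallP h i j lt_ij /eqP e.
  by have /forallP/(_ j) := h i; rewrite lt_ij e.
move=> h; apply/forallP => i; apply/forallP => j; apply/implyP.
by move=> /andP[lt_ij /eqP e]; exact: h.
Qed.

(** Used to replace a sum over shuffles by the sum over an explicit list of permutations. *)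
Lemma sum_perm_seq (V : zmodType) (N : nat) (P : pred 'S_N) (r : seq 'S_N)
    (F : 'S_N -> V) :
  uniq r -> P =1 mem r -> \sum_(s | P s) F s = \sum_(s <- r) F s.
Proof. by move=> ur Pr; rewrite big_uniq //; apply: eq_bigl => s; rewrite Pr. Qed.

Section ShuffleSums.
Variables (k : fieldType) (g : lmodType k).
Implicit Types (x : seq g) (Phi : seq (seq g) -> g).

(** [Phi] is only ever evaluated on lists of blocks whose sizes are prescribed by [bs], so a
    vanishing argument may assume this shape. The degree arguments below rest on this. *)
Lemma shuffle_sum_eq0 (bs : seq int) Phi x :
  (forall bl, all (fun b => 0 <= b) bs -> shape bl = [seq absz b | b <- bs] ->
    sumn (shape bl) = size x -> Phi bl = 0) ->
  shuffle_sum bs Phi x = 0.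
Proof.
move=> h; rewrite /shuffle_sum big1 // => s /and3P[bs_ge0 /eqP szx _].
have e : shape (reshape [seq absz b | b <- bs] (permute s x)) =
    [seq absz b | b <- bs].
  by rewrite reshapeKl // size_permute szx.
by rewrite h ?scaler0 // e.
Qed.

Let i0 : 'I_2 := ord0.
Let i1 : 'I_2 := ord_max.

Lemma perm2P (s : 'S_2) : s = 1%g \/ s = tperm i0 i1.
Proof.
have := perm_inj (s := s) (x1 := i0) (x2 := i1).
case e0 : (s i0) => [[|[|//]] h0]; case e1 : (s i1) => [[|[|//]] h1] h.
- by suff: i0 = i1 by []; apply: h; exact: val_inj.
- left; apply/permP => -[[|[|//]] hi]; rewrite perm1.
  + have -> : Ordinal hi = i0 by exact: val_inj.
    by rewrite e0; exact: val_inj.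
  + have -> : Ordinal hi = i1 by exact: val_inj.
    by rewrite e1; exact: val_inj.
- right; apply/permP => -[[|[|//]] hi].
  + have -> : Ordinal hi = i0 by exact: val_inj.
    by rewrite tpermL e0; exact: val_inj.
  + have -> : Ordinal hi = i1 by exact: val_inj.
    by rewrite tpermR e1; exact: val_inj.
- by suff: i0 = i1 by []; apply: h; exact: val_inj.
Qed.

Lemma permute2 (s : 'S_2) (a b : g) :
  permute s [:: a; b] = [:: [:: a; b]`_(s i0); [:: a; b]`_(s i1)].
Proof.
rewrite /permute !enum_ordSl enum_ord0 /=.
by congr [:: _; [:: a; b]`_(s _)]; exact: val_inj.
Qed.

(** No block contains two positions, so both permutations of two letters are shuffles. *)
Lemma shuffle_sum_1_1_0 Phi (a b : g) :
  shuffle_sum [:: 1; 1; 0] Phi [:: a; b] =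
  Phi [:: [:: a]; [:: b]; [::]] - Phi [:: [:: b]; [:: a]; [::]].
Proof.
rewrite /shuffle_sum (sum_perm_seq _ _ _ [:: 1%g; tperm i0 i1]).
- rewrite 2!big_cons big_nil addr0 !permute2 !perm1 tpermL tpermR /=.
  by rewrite odd_perm1 odd_tperm scale1r scaleN1r.
- rewrite /= inE andbT; apply/eqP => /permP/(_ i0).
  by rewrite perm1 tpermL.
- move=> s; rewrite !inE; case: (perm2P s) => ->; rewrite eqxx ?orbT;
  by apply/is_shuffleP => // -[[|[|//]] ?] [[|[|//]] ?].
Qed.

Lemma shuffle_sum_2_0 Phi (a b : g) :
  shuffle_sum [:: 2; 0] Phi [:: a; b] = Phi [:: [:: a; b]; [::]].
Proof.
rewrite /shuffle_sum (sum_perm_seq _ _ _ [:: 1%g]) //.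
- by rewrite big_seq1 permute2 !perm1 /= odd_perm1 scale1r.
- move=> s; rewrite !inE; apply/idP/eqP => [|->].
    move=> /is_shuffleP h; case: (perm2P s) h => // -> /(_ isT erefl i0 i1 isT erefl).
    by rewrite tpermL tpermR.
  by apply/is_shuffleP => // i j; rewrite !perm1.
Qed.

Let j0 : 'I_3 := ord0.
Let j1 : 'I_3 := @Ordinal 3 1 isT.
Let j2 : 'I_3 := ord_max.

Lemma permute3 (s : 'S_3) (x : seq g) :
  permute s x = [:: x`_(s j0); x`_(s j1); x`_(s j2)].
Proof.
rewrite /permute !enum_ordSl enum_ord0 /=.
by congr [:: _; x`_(s _); x`_(s _)]; exact: val_inj.
Qed.

Lemma perm3_ext (s t : 'S_3) : s j0 = t j0 -> s j1 = t j1 -> s j2 = t j2 -> s = t.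
Proof.
move=> e0 e1 e2; apply/permP => -[[|[|[|//]]] hi].
- by rewrite (_ : Ordinal hi = j0) //; exact: val_inj.
- by rewrite (_ : Ordinal hi = j1) //; exact: val_inj.
- by rewrite (_ : Ordinal hi = j2) //; exact: val_inj.
Qed.

Lemma shuffle_sum_2_1 Phi (a b c : g) :
  shuffle_sum [:: 2; 1] Phi [:: a; b; c] =
  Phi [:: [:: a; b]; [:: c]] - Phi [:: [:: a; c]; [:: b]]
  + Phi [:: [:: b; c]; [:: a]].
Proof.
(* With the identity, these are all the (2,1)-shuffles. [p2] is the 3-cycle sending 0 to 1, 1 to 2
   and 2 to 0; it is even, whence the plus sign of the last term. *)
pose p1 := tperm j1 j2; pose p2 := (tperm j0 j1 * tperm j0 j2)%g.
have p10 : p1 j0 = j0 by rewrite tpermD.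
have p11 : p1 j1 = j2 by rewrite tpermL.
have p12 : p1 j2 = j1 by rewrite tpermR.
have p20 : p2 j0 = j1 by rewrite permM tpermL tpermD.
have p21 : p2 j1 = j2 by rewrite permM tpermR tpermL.
have p22 : p2 j2 = j0 by rewrite permM [tperm j0 j1 _]tpermD // tpermR.
rewrite /shuffle_sum (sum_perm_seq _ _ _ [:: 1%g; p1; p2]).
- rewrite 3!big_cons big_nil addr0 !permute3 !perm1 p10 p11 p12 p20 p21 p22 /=.
  by rewrite odd_perm1 odd_permM !odd_tperm /= scale1r scaleN1r scale1r addrA.
- rewrite /= !inE negb_or andbT -andbA; apply/and3P; split.
  + by apply/eqP => /permP/(_ j1); rewrite perm1 p11.
  + by apply/eqP => /permP/(_ j0); rewrite perm1 p20.
  + by apply/eqP => /permP/(_ j0); rewrite p10 p20.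
- move=> s; rewrite !inE; apply/idP/or3P.
    move=> /is_shuffleP h; have {h} lt01 := h isT erefl j0 j1 isT erefl.
    have n02 : val (s j0) != val (s j2) by rewrite (inj_eq val_inj) (inj_eq perm_inj).
    have n12 : val (s j1) != val (s j2) by rewrite (inj_eq val_inj) (inj_eq perm_inj).
    have [h0 [h1 h2]] := (ltn_ord (s j0), (ltn_ord (s j1), ltn_ord (s j2))).
    (* The first two values increase, so the shuffle is determined by the value at the last
       position. *)
    have [[e0 e1 e2]|[e0 e1 e2]|[e0 e1 e2]] :
      [\/ [/\ s j0 = 0%N :> nat, s j1 = 1%N :> nat & s j2 = 2%N :> nat],
          [/\ s j0 = 0%N :> nat, s j1 = 2%N :> nat & s j2 = 1%N :> nat] |
          [/\ s j0 = 1%N :> nat, s j1 = 2%N :> nat & s j2 = 0%N :> nat]].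
    * move: lt01 n02 n12 h0 h1 h2 => /=.
      move: (nat_of_ord _) (nat_of_ord _) (nat_of_ord _) =>
        [|[|[|u]]] [|[|[|v]]] [|[|[|w]]] //= *;
      by [apply: Or31|apply: Or32|apply: Or33].
    * by apply: Or31; apply/eqP/perm3_ext; rewrite perm1; exact: val_inj.
    * by apply: Or32; apply/eqP/perm3_ext; rewrite ?p10 ?p11 ?p12; exact: val_inj.
    * by apply: Or33; apply/eqP/perm3_ext; rewrite ?p20 ?p21 ?p22; exact: val_inj.
  move=> h; apply/is_shuffleP => // i j lt_ij e.
  (* Positions 0 and 1 form the only pair lying in a common block. *)
  have [-> ->] : i = j0 /\ j = j1.
    by case: i j lt_ij e => [[|[|[|//]]] ?] [[|[|[|//]]] ?] //= _ _;
      split; exact: val_inj.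
  by case: h => /eqP ->; rewrite ?perm1 ?p10 ?p11 ?p20 ?p21.
Qed.

End ShuffleSums.

(** * Vanishing of the structure maps for degree reasons *)

Lemma multilinear_nil0 (k : fieldType) (g : lmodType k) (F : cochain g)
    (s1 s2 : seq g) : F (s1 ++ 0 :: s2) = 0.
Proof. by apply: multilinear0; exact: cochain_lin. Qed.

Lemma remove_nth_nseq (S : Type) (p j : nat) (u : S) :
  (j < p)%N -> remove_nth j (nseq p u) = nseq p.-1 u.
Proof.
move=> ltjp; rewrite /remove_nth take_nseq 1?ltnW // drop_nseq -nseqD.
by congr nseq; lia.
Qed.

Lemma all_remove_nth (S : Type) (P : pred S) (u0 : S) (j : nat) (s : seq S) :
  (j < size s)%N -> P (nth u0 s j) -> all P (remove_nth j s) -> all P s.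
Proof.
move=> ltjs Pj; rewrite -{2}(cat_take_drop j s) (drop_nth u0 ltjs) !all_cat /=.
by rewrite Pj.
Qed.

Section MaurerCartan.
Variables (k : fieldType) (g : lmodType k) (mu lambda : k) (pi T : cochain g).
Hypotheses (hpi : cochain_degree 1 pi) (hT : cochain_degree 0 T).
Implicit Types (x : seq g) (n : int) (ms : seq int) (p q : nat).

Lemma pi_eq0 x : size x != 2%N -> pi x = 0.
Proof. by move=> /eqP szx; apply: hpi => szx'; apply: szx; lia. Qed.

Lemma T_eq0 x : size x != 1%N -> T x = 0.
Proof. by move=> /eqP szx; apply: hT => szx'; apply: szx; lia. Qed.

Lemma map_zip_nseq q (bl : seq (seq g)) :
  [seq u.1 u.2 | u : cochain g * seq g <- zip (nseq q T) bl] =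
  [seq T b | b <- take q bl].
Proof. by elim: q bl => [|q IH] [|b bl] //=; rewrite IH. Qed.

(** Each [T] must receive exactly one argument, and [pi] exactly two, namely the [q] values of [T]
    together with the last block. *)
Lemma insertion_nseq_eq0 (rs : seq int) q (bl : seq (seq g)) :
  (q < size bl)%N ->
  ~~ (all (pred1 1%N) (take q (shape bl)) && (q + nth 0 (shape bl) q == 2)%N) ->
  insertion pi (nseq q T) rs bl = 0.
Proof.
move=> ltq; rewrite /insertion map_zip_nseq size_nseq negb_and => /orP[|neq2].
  rewrite -map_take all_map -has_predC => /hasP[b b_in /= szb].
  case/splitPr: b_in => B1 B2.
  by rewrite map_cat /= (T_eq0 _ szb) -catA multilinear_nil0 scaler0.
rewrite pi_eq0 ?scaler0 // size_cat size_map size_takel 1?ltnW //.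
by rewrite -[size (nth _ _ _)](nth_map [::] 0%N).
Qed.

(** Comparing block sizes with the arities of [pi] and [T] forces all degrees. In the first sum [pi]
    receives [p] values of [T] and [n + 1 - p] identities, so [n = 1], and [p <= 2] since block
    sizes are nonnegative. In the second sum there is one [T] fewer inside [pi], so [p = 3] also
    fits the sizes, and there the coefficient vanishes. *)
Lemma l_hom_eq0 n ms p x : size ms = p ->
  ~~ [&& n == 1, all (pred1 0) ms, (p <= 2)%N & size x == 2%N] ->
  l_hom mu lambda n ms pi (nseq p T) x = 0.
Proof.
move=> szms ne; rewrite /l_hom size_nseq; case: eqP => [p0|/eqP p_gt0].
  case: eqP => [szx|]; last by rewrite scaler0 oppr0.
  rewrite pi_eq0 ?scaler0 ?oppr0 //; apply: contra ne => /eqP szx2.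
  rewrite p0 szx2 (size0nil (etrans szms p0)) /= !andbT; lia.
(* Nonnegativity of [m + 1] matters here: its absolute value is 1 also at [m = -2]. *)
have nseq_abs (ms' : seq int) : all (fun b => 0 <= b) [seq m + 1 | m <- ms'] ->
    all (pred1 1%N) [seq absz b | b <- [seq m + 1 | m <- ms']] ->
    all (pred1 0) ms'.
  elim: ms' => //= m ms' IH /andP[m_ge0 /IH{}IH] /andP[/eqP m1 /IH ->].
  by rewrite andbT; lia.
have sum_abs (ms' : seq int) : all (pred1 0) ms' ->
    sumn [seq absz b | b <- [seq m + 1 | m <- ms']] = size ms'.
  by elim: ms' => //= m ms' IH /andP[/eqP-> /IH->].
rewrite shuffle_sum_eq0 ?scaler0 ?oppr0 ?add0r; last first.
  move=> bl; rewrite all_cat => /andP[ms_ge0 /andP[n_ge0 _]] shbl szx.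
  have szbl : size bl = p.+1.
    rewrite -(size_map size) -/(shape bl) shbl.
    by rewrite size_map size_cat size_map /= szms addn1.
  apply: insertion_nseq_eq0; first by rewrite szbl.
  apply: contra ne; move: szx; rewrite shbl map_cat.
  rewrite take_size_cat ?size_map // nth_cat !size_map szms ltnn subnn.
  move=> szx /andP[/(nseq_abs _ ms_ge0) ms0]; rewrite ms0.
  by move: szx; rewrite sumn_cat sum_abs // szms /=; lia.
rewrite big1 ?oppr0 // => j _.
(* The case of l_4, where the index of [B] is 1 - 4 + 3 = 0 and B_0 = 0. *)
have [/andP[/eqP p3 /eqP n1]|ne3] := boolP ((p == 3%N) && (n == 1)).
  have -> : absz (n - p.+1%:Z + 3) = 0%N by rewrite p3 n1.
  by rewrite mulr0 scale0r.
have ltj : (j < size ms)%N by rewrite szms.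
have szr : size (remove_nth j ms) = p.-1.
  by have := size_remove_nth ltj; lia.
rewrite shuffle_sum_eq0 ?scaler0 // => bl.
rewrite all_cat => /andP[ms_ge0 /and3P[n_ge0 mj_ge0 _]] shbl szx.
have szbl : size bl = p.+1.
  rewrite -(size_map size) -/(shape bl) shbl size_map size_cat size_map /= szr.
  by lia.
rewrite nth_nseq ltn_ord remove_nth_nseq //.
have shp : nth 0%N (shape bl) p = absz ms`_j.
  rewrite shbl map_cat nth_cat !size_map szr (_ : p - p.-1 = 1)%N; last by lia.
  by rewrite ltnNge leq_pred.
(* The outer [T] has arity one and already takes the value of [pi], so its block of identities, of
   size [ms_j], must be empty. *)
have [mj0|mjn0] := eqVneq ms`_j 0; last first.
  rewrite T_eq0 //= -[size (nth _ _ _)](nth_map [::] 0%N) ?szbl //.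
  by rewrite -/(shape bl) shp; lia.
rewrite insertion_nseq_eq0; first exact: (multilinear_nil0 _ _ _ [::]).
  by rewrite size_takel ?szbl //; lia.
apply: contra ne.
have -> : shape (take p bl) =
    [seq absz b | b <- [seq m + 1 | m <- remove_nth j ms]] ++
      [:: absz (n + 3 - p.+1%:Z)%R].
  rewrite /shape map_take -/(shape bl) shbl map_cat take_cat !size_map szr.
  by rewrite ltnNge leq_pred /= (_ : p - p.-1 = 1)%N //; lia.
rewrite take_size_cat ?size_map // nth_cat !size_map szr ltnn subnn.
move=> /andP[/(nseq_abs _ ms_ge0) ms0].
rewrite (all_remove_nth _ _ 0 j ms) ?mj0 //.
by move: szx; rewrite shbl map_cat sumn_cat sum_abs // szr /= mj0; lia.
Qed.

(** The argument in sm may sit in any of the [p + 1] positions. All give the same term: [T] has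
    degree 0, so moving the argument to the front costs no sign. *)
Lemma op_a_nseq p x : size x = 2%N ->
  op_a_fun mu lambda (nseq p.+1 (pi, T)) x =
    p.+1%:R *: l_hom mu lambda 1 (nseq p 0) pi (nseq p T) x.
Proof.
move=> szx; rewrite /op_a_fun; set v := nseq _ _.
have szv : size v = p.+1 by rewrite size_nseq.
have hv (j : 'I_(size v)) : [seq w.2 | w <- remove_nth j v] = nseq p T.
  by rewrite remove_nth_nseq ?map_nseq // -szv.
have vj (j : 'I_(size v)) : (nth 0 v j).1 = pi by rewrite nth_nseq -szv ltn_ord.
transitivity (\sum_(j < size v) l_hom mu lambda 1 (nseq p 0) pi (nseq p T) x).
  apply: eq_bigr => j _; rewrite vj hv.
  set bound := (_ + _).+1.
  have lt1 : (1 < bound)%N by rewrite /bound szx.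
  have lt2 : (2 < bound)%N by rewrite /bound szx szv.
  (* The summation indices are arities, one more than degrees: [pi] survives only at index 2 and
     each [T] only at index 1. *)
  rewrite (bigD1 (Ordinal lt2)) //= [X in _ + X]big1 ?addr0 => [|b]; last first.
    rewrite -(inj_eq val_inj) /= => nb2; rewrite big1 // => a _.
    rewrite l_hom_eq0 ?scaler0 //; first by rewrite size_map size_tuple size_nseq.
    by rewrite negb_and; apply/orP; left; lia.
  rewrite (bigD1 (nseq_tuple _ (Ordinal lt1))) //= [X in _ + X]big1 ?addr0 => [|a na].
    by rewrite mul0r expr0z scale1r map_nseq size_nseq.
  rewrite l_hom_eq0 ?scaler0 //; first by rewrite size_map size_tuple size_nseq.
  apply: contra na => /and3P[_ a0 _]; apply/eqP/val_inj.
  transitivity (nseq (size a) (Ordinal lt1)); last by rewrite size_tuple.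
  apply/all_pred1P.
  move: a0; rewrite all_map; apply: sub_all => c /=.
  by rewrite -(inj_eq val_inj) /=; lia.
by rewrite sumr_const card_ord szv scaler_nat.
Qed.

Lemma op_a_nseq_eq0 p x : (2 < p)%N || (size x != 2%N) ->
  op_a_fun mu lambda (nseq p.+1 (pi, T)) x = 0.
Proof.
move=> ne; rewrite /op_a_fun big1 // => j _; rewrite big1 // => b _.
rewrite big1 // => a _.
have ltj : (j < p.+1)%N by apply: leq_trans (ltn_ord j) _; rewrite size_nseq.
rewrite remove_nth_nseq // map_nseq nth_nseq ltj.
rewrite l_hom_eq0 ?scaler0 //; first by rewrite size_map size_tuple size_nseq.
by rewrite !negb_and -ltnNge ne !orbT.
Qed.

(** * The surviving values of l_1, l_2 and l_3 *)

Lemma cochain2_anti (F : cochain g) (a b : g) : F [:: b; a] = - F [:: a; b].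
Proof.
have := cochain_adj F (a + b) [::] [::] => /=.
have lF := cochain_lin F.
rewrite (multilinearD a b [::] [:: a + b] lF) /=.
rewrite (multilinearD a b [:: a] [::] lF) (multilinearD a b [:: b] [::] lF) /=.
rewrite (cochain_adj F a [::] [::]) (cochain_adj F b [::] [::]) add0r addr0.
by move/eqP; rewrite addrC addr_eq0 => /eqP.
Qed.

Lemma l_hom_pi0 x : size x = 2%N ->
  l_hom mu lambda 1 [::] pi [::] x = - (lambda *: pi x).
Proof. by move=> szx; rewrite /l_hom /= szx /= /A /B /= mulr1. Qed.

(** Here [n = 1] and [i = 2], so the coefficients are A_0 = 0 and B_2 = [mu]. *)
Lemma l_hom_pi1 (a b : g) :
  l_hom mu lambda 1 [:: 0] pi [:: T] [:: a; b] = - (mu *: T [:: pi [:: a; b]]).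
Proof.
rewrite /l_hom /= big_ord1 /= shuffle_sum_2_0 /insertion /= !big_ord0.
by rewrite /A /B /= !mulr0 expr0z !scale1r mul1r subr0 mulr1 scale0r oppr0 add0r.
Qed.

(** Here [n = 1] and [i = 3], so the coefficients are A_(-1) = -1 and B_1 = 1, and all signs from
    degrees are trivial. By antisymmetry of [pi] the two shuffles of the first sum agree, which
    doubles [pi(T, T)]; in the second sum the doubling comes from the two choices of the outer
    [T]. *)
Lemma l_hom_pi2 (a b : g) :
  l_hom mu lambda 1 [:: 0; 0] pi [:: T; T] [:: a; b] =
  2%:R *: (pi [:: T [:: a]; T [:: b]]
           - T [:: pi [:: T [:: a]; b] + pi [:: a; T [:: b]]]).
Proof.
have TD u v : T [:: u + v] = T [:: u] + T [:: v].
  exact: (multilinearD u v [::] [::] (cochain_lin T)).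
have TN u : T [:: - u] = - T [:: u].
  by apply/eqP; rewrite -addr_eq0 -TD addNr (multilinear_nil0 _ _ T [::] [::]).
rewrite /l_hom /= big_ord_recl big_ord1 /= !shuffle_sum_1_1_0 /insertion /=.
rewrite !big_ord_recl !big_ord0 /A /B /= !mulr0 !mul0r !addr0 !expr0z !scale1r.
rewrite !mul1r !scale1r scaleN1r opprK.
rewrite (cochain2_anti pi (T [:: a]) (T [:: b])) (cochain2_anti pi a (T [:: b])).
by rewrite !TN TD !opprK -!mulr2n -mulrnBl scaler_nat.
Qed.

(** * The Nijenhuis-Richardson bracket of [pi] with itself *)

Lemma nr_circ_pi_eq0 (p q : int) x :
  ~~ [&& p == 1, q == 1 & size x == 3%N] -> nr_circ p q pi pi x = 0.
Proof.
move=> ne; rewrite /nr_circ shuffle_sum_eq0 // => bl /and3P[q_ge0 p_ge0 _] shbl szx.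
have sz0 : size (nth [::] bl 0) = absz (q + 1).
  by rewrite -(nth_map _ 0%N size) -?(size_map size) -/(shape bl) shbl.
have sz1 : size (nth [::] bl 1) = absz p.
  by rewrite -(nth_map _ 0%N size) -?(size_map size) -/(shape bl) shbl.
have [q1|nq1] := eqVneq q 1; last first.
  by rewrite [pi (nth _ _ _)]pi_eq0 ?sz0 ?(multilinear_nil0 _ _ pi [::]) //; lia.
rewrite pi_eq0 //= sz1; apply: contra ne => p1.
by move: szx; rewrite shbl q1 /=; lia.
Qed.

(** As [pi] has odd degree 1, the two halves of the bracket add up to twice the composition; the
    outer minus is the sign (-1)^|f| in l_2. *)
Lemma op_m_pi (a b c : g) :
  op_m_fun pi pi [:: a; b; c] =
  - (2%:R *: (pi [:: pi [:: a; b]; c] - pi [:: pi [:: a; c]; b]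
              + pi [:: pi [:: b; c]; a])).
Proof.
(* Arities run below 5 = 3 + 2, and only arity 2, that is degree 1, contributes in each of the two
   sums. *)
rewrite /op_m_fun (bigD1 (Ordinal (isT : 2 < 5)%N)) //= [X in _ + X]big1; last first.
  move=> i; rewrite -(inj_eq val_inj) /= => ni2; rewrite big1 // => j _.
  rewrite /nr_bracket !nr_circ_pi_eq0 ?scaler0 ?subr0 ?scaler0 //= andbT; lia.
rewrite addr0 (bigD1 (Ordinal (isT : 2 < 5)%N)) //= [X in _ + X]big1; last first.
  move=> i; rewrite -(inj_eq val_inj) /= => ni2.
  rewrite /nr_bracket !nr_circ_pi_eq0 ?scaler0 ?subr0 ?scaler0 //= andbT; lia.
have -> : 2%:Z - 1 = 1 by [].
rewrite /nr_bracket.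
have -> : nr_circ 1 1 pi pi [:: a; b; c] =
    pi [:: pi [:: a; b]; c] - pi [:: pi [:: a; c]; b] + pi [:: pi [:: b; c]; a].
  exact: (shuffle_sum_2_1 _ _ (fun bl => pi (pi (nth [::] bl 0) :: nth [::] bl 1))).
by rewrite mulr1 expr1z scaleN1r scaleN1r opprK -mulr2n scaler_nat addr0.
Qed.

Lemma op_m_pi_eq0 x : size x != 3%N -> op_m_fun pi pi x = 0.
Proof.
move=> nx; rewrite /op_m_fun big1 // => i _; rewrite big1 // => j _.
by rewrite /nr_bracket !nr_circ_pi_eq0 ?scaler0 ?subr0 ?scaler0 // (negbTE nx) !andbF.
Qed.

(** * Reduction of the Maurer-Cartan series to its first three terms *)

Lemma cochain_eq0 (F : cochain g) : F = 0 <-> forall x, F x = 0.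
Proof. by split=> [-> //|F0]; apply/val_inj/funext. Qed.

(** Splits the truncated series into components; only its second term, coming from l_2, has a part
    in sm. *)
Lemma sma_sum_eq0 (u1 u2 u3 : k) (m p1 p2 p3 : cochain g) :
  u1 *: ((0, p1) : sma g) + (u2 *: ((m, p2) : sma g) + u3 *: ((0, p3) : sma g)) = 0
  <-> (forall x, u2 *: m x = 0) /\
      (forall x, u1 *: p1 x + (u2 *: p2 x + u3 *: p3 x) = 0).
Proof.
have -> : u1 *: ((0, p1) : sma g) + (u2 *: ((m, p2) : sma g) + u3 *: ((0, p3) : sma g))
    = ((u2 *: m, u1 *: p1 + (u2 *: p2 + u3 *: p3)) : sma g).
  have e : u1 *: 0 + (u2 *: m + u3 *: 0) = u2 *: m by rewrite !scaler0 add0r addr0.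
  by rewrite -e.
split=> [e|[h1 h2]]; last by apply: congr2; exact/cochain_eq0.
by split; [apply: (proj1 (cochain_eq0 (u2 *: m)) (congr1 fst e))
  | apply: (proj1 (cochain_eq0 (u1 *: p1 + (u2 *: p2 + u3 *: p3))) (congr1 snd e))].
Qed.

Lemma l_sma_nseq_eq0 (n : nat) : (3 < n)%N ->
  l_sma mu lambda (nseq n (pi, T)) = 0.
Proof.
case: n => [|[|[|[|n]]]] // _; rewrite /l_sma /=; congr (_, _).
by apply/val_inj/funext => x; exact: (@op_a_nseq_eq0 n.+3).
Qed.

Lemma maurer_cartan_sum :
  maurer_cartan (@sma_degree k g) (@l_sma k g mu lambda) (pi, T) <->
  \sum_(1 <= n < 4) (n`!%:R)^-1 *: l_sma mu lambda (nseq n (pi, T)) = 0.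
Proof.
split=> [[_ [N [lN0 sumN0]]]|sum0]; last first.
  by split=> //; exists 3%N; split=> // n; exact: l_sma_nseq_eq0.
(* The cutoff [N] is arbitrary. If [N <= 3], the terms from [N + 1] to 3 vanish by the choice of
   [N]; otherwise those from 4 to [N] vanish for degree reasons. *)
have [leN|leN] := leqP N 3.
  rewrite (@big_cat_nat _ _ _ N.+1) //= sumN0 add0r big_nat_cond big1 // => n.
  by rewrite andbT => /andP[ltNn _]; rewrite lN0 ?scaler0.
move: sumN0; rewrite (@big_cat_nat _ _ _ 4) //=; last exact: ltnW.
rewrite [X in _ + X]big_nat_cond [X in _ + X]big1 ?addr0 // => n.
by rewrite andbT => /andP[lt3n _]; rewrite l_sma_nseq_eq0 ?scaler0.
Qed.

(** * The two components of the equation in characteristic 0 *)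

Hypothesis char0 : [pchar k] =i pred0.

Lemma natr_neq0 (n : nat) : (n.+1%:R : k) != 0.
Proof. by rewrite (proj1 (GRing.pcharf0P k) char0). Qed.

Let m_component x := (2`!%:R)^-1 *: op_m_fun pi pi x.
Let a_component x :=
  (1`!%:R)^-1 *: op_a_fun mu lambda (nseq 1 (pi, T)) x +
  ((2`!%:R)^-1 *: op_a_fun mu lambda (nseq 2 (pi, T)) x +
   (3`!%:R)^-1 *: op_a_fun mu lambda (nseq 3 (pi, T)) x).

Lemma maurer_cartan_components :
  maurer_cartan (@sma_degree k g) (@l_sma k g mu lambda) (pi, T) <->
  (forall x, m_component x = 0) /\ (forall x, a_component x = 0).
Proof.
rewrite maurer_cartan_sum 3?big_ltn // big_geq // addr0.
exact: (sma_sum_eq0 _ _ _ (op_m pi pi) (op_a mu lambda (nseq 1 (pi, T)))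
  (op_a mu lambda (nseq 2 (pi, T))) (op_a mu lambda (nseq 3 (pi, T)))).
Qed.

(** The factor 1/2! cancels the 2 in the bracket of [pi] with itself. Antisymmetry then turns minus
    the composition of [pi] with itself into the cyclic Jacobi sum, and in arities other than 3
    there is no condition. *)
Lemma m_componentP : (forall x, m_component x = 0) <->
  forall a b c, pi [:: a; pi [:: b; c]] + pi [:: b; pi [:: c; a]]
                + pi [:: c; pi [:: a; b]] = 0.
Proof.
have m_componentE a b c : m_component [:: a; b; c] =
    pi [:: a; pi [:: b; c]] + pi [:: b; pi [:: c; a]] + pi [:: c; pi [:: a; b]].
  rewrite /m_component op_m_pi scalerN scalerK ?natr_neq0 //.
  have piN u v : pi [:: - u; v] = - pi [:: u; v].
    apply/eqP; rewrite -addr_eq0 -(multilinearD _ _ [::] [:: v] (cochain_lin pi)).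
    by rewrite addNr (multilinear_nil0 _ _ pi [::]).
  rewrite (cochain2_anti pi (pi [:: b; c])) (cochain2_anti pi a c).
  rewrite (cochain2_anti pi (pi [:: a; b])) (cochain2_anti pi (- pi [:: a; c])).
  by rewrite piN opprK opprD opprB addrC addrA.
split=> [h a b c|h x]; first by rewrite -m_componentE h.
case: (eqVneq (size x) 3) => [|nx].
  by case: x => [|a [|b [|c []]]] // _; rewrite m_componentE h.
by rewrite /m_component op_m_pi_eq0 ?scaler0.
Qed.

Lemma a_componentP : (forall x, a_component x = 0) <->
  forall a b, pi [:: T [:: a]; T [:: b]] =
    T [:: pi [:: T [:: a]; b] + pi [:: a; T [:: b]] + mu *: pi [:: a; b]]
    + lambda *: pi [:: a; b].
Proof.
have a_componentE a b : a_component [:: a; b] = pi [:: T [:: a]; T [:: b]] -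
    (T [:: pi [:: T [:: a]; b] + pi [:: a; T [:: b]] + mu *: pi [:: a; b]]
     + lambda *: pi [:: a; b]).
  rewrite /a_component !op_a_nseq // l_hom_pi0 // l_hom_pi1 l_hom_pi2.
  rewrite !scalerK ?natr_neq0 //.
  (* In the l_3 term the 3 counts the positions of [pi] and the 2 is the doubling found in
     [l_hom_pi2]; together they cancel 3!. *)
  have -> v : (3`!%:R)^-1 *: (3%:R *: (2%:R *: v)) = v :> g.
    by rewrite [_ *: (2%:R *: v)]scalerA -natrM scalerK ?natr_neq0.
  rewrite [_ + mu *: _]addrC (cochain_lin T mu _ _ [::] [::]) /=.
  by rewrite [LHS]addrC [- (mu *: _) + _]addrCA !opprD !addrA.
split=> [h a b|h x]; first by apply/eqP; rewrite -subr_eq0 -a_componentE h.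
case: (eqVneq (size x) 2) => [|nx].
  by case: x => [|a [|b []]] // _; rewrite a_componentE h subrr.
by rewrite /a_component !op_a_nseq_eq0 ?nx ?orbT // !scaler0 !addr0.
Qed.

(** Bilinearity and alternation of the bracket and linearity of the operator hold because [pi] and
    [T] are cochains; what remains is the Jacobi and Rota-Baxter identities. *)
Lemma rota_baxterP :
  extended_rota_baxter_lie mu lambda
    (fun a b : g => pi [:: a; b]) (fun a : g => T [:: a]) <->
  (forall a b c, pi [:: a; pi [:: b; c]] + pi [:: b; pi [:: c; a]]
                + pi [:: c; pi [:: a; b]] = 0) /\
  (forall a b, pi [:: T [:: a]; T [:: b]] =
    T [:: pi [:: T [:: a]; b] + pi [:: a; T [:: b]] + mu *: pi [:: a; b]]
    + lambda *: pi [:: a; b]).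
Proof.
split=> [[[_ _ _ jac] _ rb] //|[jac rb]]; split=> //; last first.
  by move=> c a b; exact: (cochain_lin T c a b [::] [::]).
split=> // [c a b d|c a b d|a].
- exact: (cochain_lin pi c a b [::] [:: d]).
- exact: (cochain_lin pi c a b [:: d] [::]).
- exact: (cochain_adj pi a [::] [::]).
Qed.

End MaurerCartan.

Theorem theorem5p4 (k : fieldType) (char0 : [pchar k] =i pred0)
    (mu lambda t : k) (ht : t ^+ 2 = mu ^+ 2 - 4%:R * lambda)
    (g : lmodType k) (pi T : cochain g)
    (hpi : cochain_degree 1 pi) (hT : cochain_degree 0 T) :
  maurer_cartan (@sma_degree k g) (@l_sma k g mu lambda) (pi, T) <->
  extended_rota_baxter_lie mu lambda
    (fun a b : g => pi [:: a; b]) (fun a : g => T [:: a]).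
Proof.
rewrite maurer_cartan_components // rota_baxterP.
by rewrite m_componentP // a_componentP.
Qed.
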